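(* Let $\Omega$ be a semigroup and let $(D,(\prec_\alpha)_{\alpha\in\Omega},(\succ_\alpha)_{\alpha\in\Omega})$ be a dendriform family $H$-pseudoalgebra. Define $$x*_{\alpha,\beta}y=x\succ_\alpha y+x\prec_\beta y,\qquad x,y\in D,\ \alpha,\beta\in\Omega.$$ Then $(D,( *_{\alpha,\beta})_{\alpha,\beta\in\Omega})$ is an $\Omega$-associative $H$-pseudoalgebra.
   Context: $k$ is an algebraically closed field of characteristic zero and $H$ is a cocommutative Hopf algebra over $k$ with comultiplication $\Delta$; $\otimes=\otimes_k$. For $n\ge 1$, $H^{\otimes n}$ is a right $H$-module via the iterated comultiplication, and for a left $H$-module $M$ the space $H^{\otimes n}\otimes_H M$ is a left $H^{\otimes n}$-module by left multiplication. A linear map $*: L\otimes M\to H^{\otimes 2}\otimes_H N$ is $H^{\otimes 2}$-linear if $fa*gb=((f\otimes g)\otimes_H 1)(a*b)$ for all $f,g\in H$. Such maps are composed as follows: if $x*y=\sum_i (f_i\otimes g_i)\otimes_H e_i$ and $F\in H^{\otimes 2}$, then $$(F\otimes_H x)*y=\sum_i (F\otimes 1)(\Delta\otimes \mathrm{id})(f_i\otimes g_i)\otimes_H e_i,\qquad x*(F\otimes_H y)=\sum_i (1\otimes F)(\mathrm{id}\otimes\Delta)(f_i\otimes g_i)\otimes_H e_i,$$ elements of $H^{\otimes 3}\otimes_H N$. A dendriform family $H$-pseudoalgebra is a left $H$-module $D$ with $H^{\otimes 2}$-linear maps $\prec_\alpha,\succ_\alpha:D\otimes D\to H^{\otimes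 2}\otimes_H D$ for each $\alpha\in\Omega$ such that for all $x,y,z\in D$, $\alpha,\beta\in\Omega$: $(x\prec_\alpha y)\prec_\beta z=x\prec_{\alpha\beta}(y\prec_\beta z+y\succ_\alpha z)$; $(x\succ_\alpha y)\prec_\beta z=x\succ_\alpha(y\prec_\beta z)$; $(x\prec_\beta y+x\succ_\alpha y)\succ_{\alpha\beta}z=x\succ_\alpha(y\succ_\beta z)$. An $\Omega$-associative $H$-pseudoalgebra is a left $H$-module $A$ with $H^{\otimes 2}$-linear maps $*_{\alpha,\beta}:A\otimes A\to H^{\otimes 2}\otimes_H A$ ($\alpha,\beta\in\Omega$) such that $(a*_{\alpha,\beta}b)*_{\alpha\beta,\gamma}c=a*_{\alpha,\beta\gamma}(b*_{\beta,\gamma}c)$ for all $a,b,c\in A$, $\alpha,\beta,\gamma\in\Omega$. *)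

(* Defs.v *)
From HB Require Import structures.
From mathcomp Require Import all_boot all_algebra generic_quotient.
From mathcomp Require Import boolp classical_sets.

Set Implicit Arguments.
Unset Strict Implicit.
Unset Printing Implicit Defensive.

Import GRing.Theory.
Local Open Scope ring_scope.
Local Open Scope quotient_scope.

(* M ⊗_S N for a right S-module M, whose action [ract] is an explicit argument,
   and a left S-module N: formal sums of pairs modulo the congruence generated
   by biadditivity and balancedness. *)
Section Tensor.
Context (S : pzRingType) (M : zmodType) (ract : M -> S -> M) (N : lmodType S).

Inductive tensor_eq : seq (M * N) -> seq (M * N) -> Prop :=
| teq_refl s : tensor_eq s s
| teq_sym s t : tensor_eq s t -> tensor_eq t s
| teq_trans s t u : tensor_eq s t -> tensor_eq t u -> tensor_eq s u
| teq_cat s s' t t' :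
    tensor_eq s s' -> tensor_eq t t' -> tensor_eq (s ++ t) (s' ++ t')
| teq_comm s t : tensor_eq (s ++ t) (t ++ s)
| teq_zero n : tensor_eq [:: (0, n)] [::]
| teq_addl m m' n : tensor_eq [:: (m + m', n)] [:: (m, n); (m', n)]
| teq_addr m n n' : tensor_eq [:: (m, n + n')] [:: (m, n); (m, n')]
| teq_bal m (c : S) n : tensor_eq [:: (ract m c, n)] [:: (m, c *: n)].

Definition tensor_eqb s t := `[< tensor_eq s t >].

Lemma tensor_eqb_refl : reflexive tensor_eqb.
Proof. by move=> s; apply/asboolP; exact: teq_refl. Qed.
Lemma tensor_eqb_sym : symmetric tensor_eqb.
Proof. by move=> s t; apply/asboolP/asboolP; exact: teq_sym. Qed.
Lemma tensor_eqb_trans : transitive tensor_eqb.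
Proof.
by move=> t s u /asboolP st /asboolP tu; apply/asboolP; exact: teq_trans tu.
Qed.

Canonical tensor_equiv :=
  EquivRel tensor_eqb tensor_eqb_refl tensor_eqb_sym tensor_eqb_trans.

Definition tensor : Type := {eq_quot tensor_equiv}.
HB.instance Definition _ := Choice.on tensor.
HB.instance Definition _ := EqQuotient.on tensor.

Definition tclass (s : seq (M * N)) : tensor := \pi_tensor s.
Definition tpure (m : M) (n : N) : tensor := tclass [:: (m, n)].

Lemma tclassP s t : tclass s = tclass t <-> tensor_eq s t.
Proof.
split=> [/eqP|st]; first by rewrite /tclass eqmodE => /asboolP.
by apply/eqP; rewrite /tclass eqmodE; apply/asboolP.
Qed.

Lemma repr_tclass s : tensor_eq (repr (tclass s)) s.
Proof. by apply/tclassP; rewrite /tclass reprK. Qed.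

Lemma tclass_repr (u : tensor) : tclass (repr u) = u.
Proof. by rewrite /tclass reprK. Qed.

Definition tzero : tensor := tclass [::].
Definition tadd (u v : tensor) : tensor := tclass (repr u ++ repr v).
Definition topp (u : tensor) : tensor := tclass [seq (- p.1, p.2) | p <- repr u].

Lemma tclass_cat s t : tclass (s ++ t) = tadd (tclass s) (tclass t).
Proof. by apply/tclassP/teq_sym/teq_cat; exact: repr_tclass. Qed.

Lemma taddA : associative tadd.
Proof.
move=> u v w; rewrite -(tclass_repr u) -(tclass_repr v) -(tclass_repr w).
by rewrite -!tclass_cat catA.
Qed.
Lemma taddC : commutative tadd.
Proof.
move=> u v; rewrite -(tclass_repr u) -(tclass_repr v) -!tclass_cat.
by apply/tclassP/teq_comm.
Qed.
Lemma tadd0 : left_id tzero tadd.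
Proof. by move=> u; rewrite -(tclass_repr u) -tclass_cat. Qed.

Lemma taddN : left_inverse tzero topp tadd.
Proof.
move=> u; rewrite -{2}(tclass_repr u) /topp -tclass_cat.
elim: (repr u) => //= -[m n] s IHs.
rewrite -(cat1s (m, n)) -cat1s !tclass_cat.
rewrite [X in tadd _ X]taddA (taddC _ (tclass [:: (m, n)])) -taddA taddA.
rewrite -[X in tadd _ X]tclass_cat IHs -tclass_cat -tclass_cat cats0 /=.
apply/tclassP; apply: teq_trans (teq_zero n).
by have := teq_sym (teq_addl (- m) m n); rewrite addNr.
Qed.

HB.instance Definition _ := GRing.isZmodule.Build tensor taddA taddC tadd0 taddN.

Lemma tclassE s : tclass s = \sum_(p <- s) tpure p.1 p.2.
Proof.
elim: s => [|[m n] s IHs]; first by rewrite big_nil.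
by rewrite big_cons -IHs -cat1s tclass_cat.
Qed.

Lemma tensor_repr (u : tensor) : u = \sum_(p <- repr u) tpure p.1 p.2.
Proof. by rewrite -tclassE tclass_repr. Qed.

Lemma tensor_ind (P : tensor -> Prop) : P 0 ->
  (forall u v, P u -> P v -> P (u + v)) -> (forall m n, P (tpure m n)) ->
  forall u, P u.
Proof.
move=> P0 PD Pp u; rewrite (tensor_repr u).
by apply: (big_ind P) => // p _; exact: Pp.
Qed.

Lemma tpureDl n : {morph tpure^~ n : m m' / m + m'}.
Proof.
move=> m m' /=; rewrite [RHS](esym (tclass_cat _ _)).
by apply/tclassP; exact: teq_addl.
Qed.
Lemma tpureDr m : {morph tpure m : n n' / n + n'}.
Proof.
move=> n n' /=; rewrite [RHS](esym (tclass_cat _ _)).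
by apply/tclassP; exact: teq_addr.
Qed.
Lemma tpure_bal m c n : tpure (ract m c) n = tpure m (c *: n).
Proof. by apply/tclassP; exact: teq_bal. Qed.

Definition balanced (G : zmodType) (f : M -> N -> G) :=
  [/\ forall n, {morph f^~ n : m m' / m + m'},
      forall m, {morph f m : n n' / n + n'}
    & forall m c n, f (ract m c) n = f m (c *: n)].

(* The additive map induced by f; meaningful when f is balanced (tliftE),
   otherwise it depends on the choice of representatives. *)
Definition tlift (G : zmodType) (f : M -> N -> G) (u : tensor) : G :=
  \sum_(p <- repr u) f p.1 p.2.

Section Lift.
Context (G : zmodType) (f : M -> N -> G) (balf : balanced f).

Lemma balanced0 n : f 0 n = 0.
Proof. by apply: (addrI (f 0 n)); rewrite -(let: And3 h _ _ := balf in h) !addr0. Qed.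

Lemma tlift_class s : tlift f (tclass s) = \sum_(p <- s) f p.1 p.2.
Proof.
case: (balf) => fDl fDr fbal.
rewrite /tlift; move: (repr _) (repr_tclass s) => r rs.
elim: {r s} rs => //.
- by move=> ? ? ? _ -> _ ->.
- by move=> ? ? ? ? _ IH1 _ IH2; rewrite !big_cat IH1 IH2.
- by move=> ? ?; rewrite !big_cat /= addrC.
- by move=> n; rewrite big_seq1 big_nil /= balanced0.
- by move=> m m' n; rewrite !big_cons !big_nil /= !addr0 fDl.
- by move=> m n n'; rewrite !big_cons !big_nil /= !addr0 fDr.
- by move=> m c n; rewrite !big_seq1 /= fbal.
Qed.

Lemma tliftE m n : tlift f (tpure m n) = f m n.
Proof. by rewrite tlift_class big_seq1. Qed.

Lemma tliftD : {morph tlift f : u v / u + v}.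
Proof.
move=> u v /=; rewrite -(tclass_repr u) -(tclass_repr v).
by rewrite -[_ + _]tclass_cat !tlift_class big_cat.
Qed.

Lemma tlift0 : tlift f 0 = 0.
Proof. by apply: (addrI (tlift f 0)); rewrite -tliftD !addr0. Qed.
End Lift.

Lemma tlift_ext (G : zmodType) (f g : M -> N -> G) :
  f =2 g -> tlift f =1 tlift g.
Proof. by move=> fg u; apply: eq_bigr => p _; rewrite fg. Qed.

Lemma tensor_additive_eq (G : zmodType) (f g : tensor -> G) :
  {morph f : u v / u + v} -> {morph g : u v / u + v} ->
  (forall m n, f (tpure m n) = g (tpure m n)) -> f =1 g.
Proof.
move=> fD gD fg; apply: tensor_ind => // [|u v fu fv].
  have z (h : tensor -> G) : {morph h : u v / u + v} -> h 0 = 0.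
    by move=> hD; apply: (addrI (h 0)); rewrite -hD !addr0.
  by rewrite !z.
by rewrite fD gD fu fv.
Qed.

End Tensor.

Section TensorK.
Context (k : comPzRingType) (M N : lmodType k).

Definition kract (m : M) (c : k) : M := c *: m.
Definition kten : Type := tensor kract N.
HB.instance Definition _ := GRing.Zmodule.on kten.

Definition ktens (m : M) (n : N) : kten := tpure kract m n.

Definition klift (G : zmodType) (f : M -> N -> G) : kten -> G :=
  @tlift _ _ kract _ _ f.

Definition bilin (V : lmodType k) (f : M -> N -> V) :=
  (forall n, linear (f^~ n)) /\ (forall m, linear (f m)).

Lemma bilin_balanced (V : lmodType k) (f : M -> N -> V) :
  bilin f -> balanced kract f.
Proof.
case=> fl fr.
have fl0 n : f 0 n = 0.
  by apply: (addrI (f 0 n)); have := fl n 1 0 0; rewrite !scale1r !addr0 => <-.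
have fr0 m : f m 0 = 0.
  by apply: (addrI (f m 0)); have := fr m 1 0 0; rewrite !scale1r !addr0 => <-.
split=> [n m m'|m n n'|m c n] /=.
- by have := fl n 1 m m'; rewrite !scale1r.
- by have := fr m 1 n n'; rewrite !scale1r.
- have := fl n c m 0; have := fr m c n 0.
  by rewrite /kract !addr0 fr0 fl0 !addr0 => -> ->.
Qed.

Definition kscale (c : k) (u : kten) : kten :=
  klift (fun m n => ktens (c *: m) n) u.

Lemma kscale_bal c : balanced kract (fun m n => ktens (c *: m) n).
Proof.
split=> [n m m'|m n n'|m d n] /=; rewrite /ktens.
- by rewrite scalerDr tpureDl.
- by rewrite tpureDr.
- by rewrite -tpure_bal /kract !scalerA mulrC.
Qed.

Lemma kscaleE c m n : kscale c (ktens m n) = ktens (c *: m) n.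
Proof. exact: tliftE (kscale_bal c) _ _. Qed.

Lemma kscaleD c : {morph kscale c : u v / u + v}.
Proof. exact: tliftD (kscale_bal c). Qed.

Lemma kscaleA a b u : kscale a (kscale b u) = kscale (a * b) u.
Proof.
move: u; apply: tensor_additive_eq => [u v|u v|m n] /=; rewrite ?kscaleD //.
by rewrite !kscaleE scalerA.
Qed.
Lemma kscale1 : left_id 1 kscale.
Proof.
by apply: tensor_additive_eq => [u v|//|m n]; rewrite ?kscaleD // kscaleE scale1r.
Qed.
Lemma kscaleDl u : {morph kscale^~ u : a b / a + b}.
Proof.
move=> a b; move: u; apply: tensor_additive_eq => [u v|u v|m n] /=.
- exact: kscaleD.
- by rewrite !kscaleD addrACA.
- by rewrite !kscaleE scalerDl /ktens tpureDl.
Qed.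

HB.instance Definition _ :=
  GRing.Zmodule_isLmodule.Build k kten kscaleA kscale1 kscaleD kscaleDl.

Lemma ktensDl n : {morph ktens^~ n : m m' / m + m'}.
Proof. exact: tpureDl. Qed.
Lemma ktensDr m : {morph ktens m : n n' / n + n'}.
Proof. exact: tpureDr. Qed.
Lemma ktensZl c m n : ktens (c *: m) n = c *: ktens m n.
Proof. by rewrite -kscaleE. Qed.
Lemma ktensZr c m n : ktens m (c *: n) = c *: ktens m n.
Proof. by rewrite -ktensZl [RHS]tpure_bal. Qed.

Lemma ktens_ind (P : kten -> Prop) : P 0 ->
  (forall u v, P u -> P v -> P (u + v)) -> (forall m n, P (ktens m n)) ->
  forall u, P u.
Proof. exact: tensor_ind. Qed.

Lemma ktens_eq (G : zmodType) (f g : kten -> G) :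
  {morph f : u v / u + v} -> {morph g : u v / u + v} ->
  (forall m n, f (ktens m n) = g (ktens m n)) -> f =1 g.
Proof. exact: tensor_additive_eq. Qed.

Section KLift.
Context (V : lmodType k) (f : M -> N -> V) (bf : bilin f).

Lemma kliftE m n : klift f (ktens m n) = f m n.
Proof. exact: tliftE (bilin_balanced bf) _ _. Qed.

Lemma klift_linear : linear (klift f).
Proof.
have fD : {morph klift f : u v / u + v} by exact: tliftD (bilin_balanced bf).
have f0 : klift f 0 = 0 by exact: tlift0 (bilin_balanced bf).
move=> c u v; rewrite fD; congr (_ + _).
move: u; apply: ktens_eq => [u w|u w|m n] /=; rewrite ?scalerDr ?fD //.
  by rewrite scalerDr.
rewrite -ktensZl !kliftE; case: (bf) => /(_ n c m 0) + _.
have -> : f 0 n = 0 by case: (bilin_balanced bf) => h _ _;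
  apply: (addrI (f 0 n)); rewrite -h !addr0.
by rewrite !addr0.
Qed.
End KLift.

End TensorK.

Arguments kten {k} (M N)%_type.
Notation "M ⊗ N" := (kten M N) (at level 40, left associativity) : type_scope.
Notation "m ⊗ n" := (ktens m n) (at level 40, left associativity) : ring_scope.

(* A vector of a k-space is separated from 0 by a linear functional; needed for
   1 ⊗ 1 <> 0, i.e. for the tensor product of algebras to be an algebra. *)
Section Functional.
Context (k : fieldType) (V : lmodType k) (v : V) (v0 : v != 0).
Local Open Scope classical_set_scope.

Lemma exists_functional : exists f : V -> k, scalar f /\ f v = 1.
Proof.
pose P (W : set V) :=
  (forall (c : k) x y, W x -> W y -> W (c *: x + y)) /\ ~ W v.
have [W [[Wlin Wv] Wmax]] : exists W, P W /\ forall B, W `<` B -> ~ P B.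
  apply: Zorn_bigcup => F FP Ftot; split; last by case=> X FX /=; case: (FP X FX).
  move=> c x y [X FX Xx] [Y FY Yy].
  have [XY|YX] := Ftot X Y FX FY.
    by exists Y => //; case: (FP Y FY) => h _; apply: h => //; exact: XY.
  by exists X => //; case: (FP X FX) => h _; apply: h => //; exact: YX.
have W0 : W 0.
  apply: contrapT => nW0.
  have nW x : ~ W x.
    by move=> Wx; apply: nW0; have := Wlin (-1) x x Wx Wx; rewrite scaleN1r addNr.
  apply: (Wmax [set 0]).
    by split=> [x /nW //|E]; apply: nW0; apply: E.
  split=> [c x y -> ->|/esym /eqP]; first by rewrite scaler0 addr0.
  by rewrite eq_sym (negbTE v0).
have WZ c x : W x -> W (c *: x) by move=> Wx; rewrite -[_ *: _]addr0; apply: Wlin.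
have WD x y : W x -> W y -> W (x + y) by rewrite -{2}[x]scale1r; exact: Wlin.
have dec x : exists c : k, W (x - c *: v).
  have [Wx|nWx] := pselect (W x); first by exists 0; rewrite scale0r subr0.
  pose B := [set z : V | exists c : k, W (z - c *: x)].
  have WB : W `<` B.
    split=> [z Wz|E]; first by exists 0; rewrite scale0r subr0.
    by apply: nWx; apply: E; exists 1; rewrite scale1r subrr.
  have : B v.
    apply: contrapT => nBv; apply: (Wmax B WB); split=> // c y z [a Wa] [b Wb].
    exists (c * a + b); rewrite scalerDl opprD addrACA -scalerA -scalerBr.
    exact: Wlin.
  case=> c Wc; have c0 : c != 0.
    by apply/eqP=> c0; apply: Wv; move: Wc; rewrite c0 scale0r subr0.
  exists c^-1; have := WZ (- c^-1) _ Wc.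
  by rewrite scalerBr scalerA mulNr mulVf // scaleN1r opprK addrC scaleNr.
have uniq x a b : W (x - a *: v) -> W (x - b *: v) -> a = b.
  move=> Wa Wb; apply/eqP; rewrite -subr_eq0; apply: contrapT => /negP ab.
  apply: Wv; have := WZ ((a - b)^-1) _ (WD _ _ Wb (WZ (-1) _ Wa)).
  by rewrite scaleN1r opprB [X in _ *: X]addrC addrA subrK -scalerBl scalerA mulVf // scale1r.
pose f x := projT1 (cid (dec x)).
have fP x : W (x - f x *: v) by rewrite /f; case: cid.
exists f; split=> [c x y|]; last first.
  by apply: (uniq v) (fP v) _; rewrite scale1r subrr.
apply: (uniq (c *: x + y)) (fP _) _.
rewrite scalerDl opprD addrACA -scalerA -scalerBr.
by apply: Wlin; exact: fP.
Qed.
End Functional.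

Section TensorAlg.
Context (k : fieldType) (A B : algType k).

Let mul1 (a : A) (b : B) : A ⊗ B -> A ⊗ B :=
  klift (fun c d => (a * c) ⊗ (b * d)).

Definition kmul (u v : A ⊗ B) : A ⊗ B := klift (fun a b => mul1 a b v) u.

Let bilin1 a b : bilin (fun c d => ((a * c) ⊗ (b * d) : A ⊗ B)).
Proof.
split=> x c y z; rewrite mulrDr -scalerAr.
  by rewrite ktensDl ktensZl.
by rewrite ktensDr ktensZr.
Qed.

Let mul1E a b c d : mul1 a b (c ⊗ d) = (a * c) ⊗ (b * d).
Proof. exact: kliftE (bilin1 a b) _ _. Qed.

Let mul1_linear a b : linear (mul1 a b).
Proof. exact: klift_linear (bilin1 a b). Qed.

Let mul1D a b : {morph mul1 a b : u v / u + v}.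
Proof. by move=> u v; have := mul1_linear a b 1 u v; rewrite !scale1r. Qed.

Let bilin2 v : bilin (fun a b => mul1 a b v).
Proof.
split=> x c y z; move: v; apply: ktens_eq => [u v|u v|m n] /=;
  rewrite ?mul1D ?scalerDr //; first 1 [by rewrite addrACA] || idtac.
- by rewrite !mul1E mulrDl -scalerAl ktensDl ktensZl.
- by rewrite addrACA.
- by rewrite !mul1E mulrDl -scalerAl ktensDr ktensZr.
Qed.

Lemma kmulE a b c d : kmul (a ⊗ b) (c ⊗ d) = (a * c) ⊗ (b * d).
Proof. by rewrite /kmul (kliftE (bilin2 _)) mul1E. Qed.

Lemma kmulDl : left_distributive kmul +%R.
Proof.
move=> u v w; have := klift_linear (bilin2 w) 1 u v.
by rewrite !scale1r.
Qed.

Lemma kmulDr : right_distributive kmul +%R.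
Proof.
move=> u v w; move: u; apply: ktens_eq => [x y|x y|m n] /=.
- exact: kmulDl.
- by rewrite !kmulDl addrACA.
- by rewrite /kmul !(kliftE (bilin2 _)) mul1D.
Qed.

Lemma kmulA : associative kmul.
Proof.
move=> u v w; move: u; apply: ktens_eq => [x y|x y|a b] /=; rewrite ?kmulDl //.
move: v; apply: ktens_eq => [x y|x y|c d] /=; rewrite ?(kmulDl, kmulDr) //.
move: w; apply: ktens_eq => [x y|x y|e f] /=; rewrite ?(kmulDl, kmulDr) //.
by rewrite !kmulE !mulrA.
Qed.

Lemma kmul1l : left_id (1 ⊗ 1) kmul.
Proof.
by apply: ktens_eq => [x y|//|a b] /=; rewrite ?kmulDr // kmulE !mul1r.
Qed.

Lemma kmul1r : right_id (1 ⊗ 1) kmul.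
Proof.
by apply: ktens_eq => [x y|//|a b] /=; rewrite ?kmulDl // kmulE !mulr1.
Qed.

Lemma kone_neq0 : (1 : A) ⊗ (1 : B) != 0.
Proof.
have [f [flin f1]] := exists_functional (oner_neq0 A).
have [g [glin g1]] := exists_functional (oner_neq0 B).
pose h (a : A) (b : B) : k^o := f a * g b.
have bh : bilin h.
  split=> x c y z; rewrite /h ?flin ?glin.
    by rewrite mulrDl -mulrA.
  by rewrite mulrDr; congr (_ + _); rewrite /= mulrCA.
apply/eqP => E; have := kliftE bh 1 1; rewrite E /h f1 g1 mulr1 => h0.
have := tlift0 (bilin_balanced bh); rewrite -[LHS]/(klift h 0) h0 => /eqP.
by rewrite oner_eq0.
Qed.

HB.instance Definition _ := GRing.Zmodule_isNzRing.Build (kten A B)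
  kmulA kmul1l kmul1r kmulDl kmulDr kone_neq0.

Lemma ktensM a b c d : ((a ⊗ b) * (c ⊗ d) : A ⊗ B) = (a * c) ⊗ (b * d).
Proof. exact: kmulE. Qed.

Lemma ktens1 : (1 : A ⊗ B) = 1 ⊗ 1.
Proof. by []. Qed.

Fact kscaleAl c (u v : A ⊗ B) : c *: (u * v) = (c *: u) * v.
Proof.
move: u; apply: ktens_eq => [x y|x y|a b] /=; rewrite ?(mulrDl, scalerDr) ?mulrDl //.
move: v; apply: ktens_eq => [x y|x y|d e] /=; rewrite ?(mulrDr, scalerDr) //.
by rewrite -ktensZl !ktensM -scalerAl ktensZl.
Qed.
HB.instance Definition _ := GRing.Lmodule_isLalgebra.Build k (kten A B) kscaleAl.

Fact kscaleAr c (u v : A ⊗ B) : c *: (u * v) = u * (c *: v).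
Proof.
move: u; apply: ktens_eq => [x y|x y|a b] /=; rewrite ?(mulrDl, scalerDr) //.
move: v; apply: ktens_eq => [x y|x y|d e] /=; rewrite ?(mulrDr, scalerDr) ?mulrDr //.
by rewrite -ktensZl !ktensM -scalerAr ktensZl.
Qed.
HB.instance Definition _ := GRing.Lalgebra_isAlgebra.Build k (kten A B) kscaleAr.

End TensorAlg.

Section KMap.
Context (k : comPzRingType) (M N M' N' : lmodType k).
Context (f : {linear M -> M'}) (g : {linear N -> N'}).

Definition kmap : M ⊗ N -> M' ⊗ N' := klift (fun m n => f m ⊗ g n).

Lemma kmap_bilin : bilin (fun m n => f m ⊗ g n).
Proof.
split=> x c y z; rewrite linearP; first by rewrite ktensDl ktensZl.
by rewrite ktensDr ktensZr.
Qed.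

Lemma kmapE m n : kmap (m ⊗ n) = f m ⊗ g n.
Proof. exact: kliftE kmap_bilin _ _. Qed.

HB.instance Definition _ :=
  GRing.isLinear.Build k (M ⊗ N)%type (M' ⊗ N')%type _ kmap
    (klift_linear kmap_bilin).
End KMap.

Section KMapAlg.
Context (k : fieldType) (A B A' B' : algType k).
Context (f : {lrmorphism A -> A'}) (g : {lrmorphism B -> B'}).

Fact kmap_monoid_morphism : monoid_morphism (kmap f g).
Proof.
split=> [|u v]; first by rewrite !ktens1 kmapE !rmorph1.
move: u; apply: ktens_eq => [x y|x y|a b] /=; rewrite ?(mulrDl, raddfD) ?mulrDl //.
move: v; apply: ktens_eq => [x y|x y|c d] /=; rewrite ?(mulrDr, raddfD) ?mulrDr //.
by rewrite ktensM !kmapE ktensM !rmorphM.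
Qed.
HB.instance Definition _ :=
  GRing.isMonoidMorphism.Build (A ⊗ B)%type (A' ⊗ B')%type (kmap f g)
    kmap_monoid_morphism.
End KMapAlg.

Section KAssoc.
Context (k : fieldType) (A B C : algType k).

Let kassoc1 (a : A) : B ⊗ C -> A ⊗ B ⊗ C := klift (fun b c => a ⊗ b ⊗ c).

Definition kassoc : A ⊗ (B ⊗ C) -> A ⊗ B ⊗ C := klift kassoc1.

Let bilin1 (a : A) : bilin (fun (b : B) (c : C) => a ⊗ b ⊗ c).
Proof.
split=> x c y z; first by rewrite ktensDr ktensZr ktensDl ktensZl.
by rewrite ktensDr ktensZr.
Qed.

Let bilin2 : bilin kassoc1.
Proof.
split=> [x c y z|a]; last exact: klift_linear (bilin1 a).
have D a : {morph kassoc1 a : u v / u + v}.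
  by move=> u v; have := klift_linear (bilin1 a) 1 u v; rewrite !scale1r.
move: x; apply: ktens_eq => [u v|u v|b d] /=; rewrite ?D ?scalerDr //.
  by rewrite addrACA.
by rewrite /kassoc1 !(kliftE (bilin1 _)) !(ktensDl, ktensZl).
Qed.

Lemma kassocE a b c : kassoc (a ⊗ (b ⊗ c)) = a ⊗ b ⊗ c.
Proof. by rewrite /kassoc (kliftE bilin2) /kassoc1 (kliftE (bilin1 _)). Qed.

HB.instance Definition _ :=
  GRing.isLinear.Build k (A ⊗ (B ⊗ C))%type (A ⊗ B ⊗ C)%type _ kassoc
    (klift_linear bilin2).

Fact kassoc_monoid_morphism : monoid_morphism kassoc.
Proof.
split=> [|u v]; first by rewrite !ktens1 kassocE.
move: u; apply: ktens_eq => [x y|x y|a u] /=; rewrite ?(mulrDl, raddfD) ?mulrDl //.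
move: v; apply: ktens_eq => [x y|x y|b v] /=; rewrite ?(mulrDr, raddfD) ?mulrDr //.
move: u; apply: ktens_eq => [x y|x y|a1 a2] /=;
  rewrite ?(ktensDr, mulrDl, raddfD) ?mulrDl //.
move: v; apply: ktens_eq => [x y|x y|b1 b2] /=;
  rewrite ?(ktensDr, mulrDr, raddfD) ?mulrDr //.
by rewrite !ktensM !kassocE !ktensM.
Qed.
HB.instance Definition _ :=
  GRing.isMonoidMorphism.Build (A ⊗ (B ⊗ C))%type (A ⊗ B ⊗ C)%type kassoc
    kassoc_monoid_morphism.
End KAssoc.

HB.mixin Record Algebra_isHopf (k : fieldType) H of GRing.Algebra k H := {
  comult : {lrmorphism H -> (H ⊗ H)%type};
  counit : {lrmorphism H -> k^o};
  antipode : {linear H -> H};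
  comultA : forall h,
    kmap comult idfun (comult h) = kassoc (kmap idfun comult (comult h));
  counitl : forall h, klift (fun a b => counit a *: b) (comult h) = h;
  counitr : forall h, klift (fun a b => counit b *: a) (comult h) = h;
  antipodel : forall h, klift (fun a b => antipode a * b) (comult h) = (counit h)%:A;
  antipoder : forall h, klift (fun a b => a * antipode b) (comult h) = (counit h)%:A
}.

#[short(type="hopfAlgType")]
HB.structure Definition HopfAlgebra (k : fieldType) :=
  {H of GRing.Algebra k H & Algebra_isHopf k H}.

HB.mixin Record HopfAlgebra_isCocommutative (k : fieldType) H of HopfAlgebra k H := {
  comultC : forall h : H, klift (fun a b => b ⊗ a) (comult h) = comult h
}.

#[short(type="cocomHopfAlgType")]
HB.structure Definition CocomHopfAlgebra (k : fieldType) :=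
  {H of HopfAlgebra k H & HopfAlgebra_isCocommutative k H}.

(* A ⊗_H N for an algebra A which is a right H-module through h |-> phi h,
   with its left A-module structure by left multiplication. *)
Section TensorH.
Context (k : fieldType) (H A : algType k) (phi : H -> A) (N : lmodType H).

Definition hract (F : A) (h : H) : A := F * phi h.
Definition hten : Type := tensor hract N.
HB.instance Definition _ := GRing.Zmodule.on hten.

Definition htens (F : A) (n : N) : hten := tpure hract F n.

Definition hlift (G : zmodType) (f : A -> N -> G) : hten -> G :=
  @tlift _ _ hract _ _ f.

Lemma htensDl n : {morph htens^~ n : F G / F + G}.
Proof. exact: tpureDl. Qed.
Lemma htensDr F : {morph htens F : n n' / n + n'}.
Proof. exact: tpureDr. Qed.
Lemma htens_bal F h n : htens (F * phi h) n = htens F (h *: n).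
Proof. exact: (tpure_bal hract). Qed.

Lemma htens_eq (G : zmodType) (f g : hten -> G) :
  {morph f : u v / u + v} -> {morph g : u v / u + v} ->
  (forall F n, f (htens F n) = g (htens F n)) -> f =1 g.
Proof. exact: tensor_additive_eq. Qed.

Definition hscale (F : A) (u : hten) : hten := hlift (fun G n => htens (F * G) n) u.

Lemma hscale_bal F : balanced hract (fun G n => htens (F * G) n).
Proof.
split=> [n G G'|G n n'|G h n] /=; first by rewrite mulrDr htensDl.
  by rewrite htensDr.
by rewrite /hract mulrA htens_bal.
Qed.

Lemma hscaleE F G n : hscale F (htens G n) = htens (F * G) n.
Proof. exact: tliftE (hscale_bal F) _ _. Qed.

Lemma hscaleD F : {morph hscale F : u v / u + v}.
Proof. exact: tliftD (hscale_bal F). Qed.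

Lemma hscaleA F G u : hscale F (hscale G u) = hscale (F * G) u.
Proof.
move: u; apply: htens_eq => [u v|u v|m n] /=; rewrite ?hscaleD //.
by rewrite !hscaleE mulrA.
Qed.
Lemma hscale1 : left_id 1 hscale.
Proof.
by apply: htens_eq => [u v|//|m n]; rewrite ?hscaleD // hscaleE mul1r.
Qed.
Lemma hscaleDl u : {morph hscale^~ u : F G / F + G}.
Proof.
move=> F G; move: u; apply: htens_eq => [u v|u v|m n] /=.
- exact: hscaleD.
- by rewrite !hscaleD addrACA.
- by rewrite !hscaleE mulrDl htensDl.
Qed.

HB.instance Definition _ :=
  GRing.Zmodule_isLmodule.Build A hten hscaleA hscale1 hscaleD hscaleDl.

Lemma scale_htens F G n : F *: htens G n = htens (F * G) n.
Proof. exact: hscaleE. Qed.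
End TensorH.

Section Pseudo.
Context (k : fieldType) (H : hopfAlgType k).

Definition H2 : Type := H ⊗ H.
HB.instance Definition _ := GRing.Algebra.on H2.
Definition H3 : Type := H ⊗ H ⊗ H.
HB.instance Definition _ := GRing.Algebra.on H3.

(* H^⊗3 is (H ⊗ H) ⊗ H, so elements of H ⊗ (H ⊗ H) are moved by kassoc. *)
Definition comult_id : H2 -> H3 := kmap comult idfun.
Definition id_comult (G : H2) : H3 := kassoc (kmap idfun comult G).

Definition comult2 : H -> H2 := comult.
Definition comult3 (h : H) : H3 := comult_id (comult2 h).

Definition H2ten (N : lmodType H) : Type := hten comult2 N.
HB.instance Definition _ N := GRing.Lmodule.on (H2ten N).
Definition H3ten (N : lmodType H) : Type := hten comult3 N.
HB.instance Definition _ N := GRing.Lmodule.on (H3ten N).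

(* op : L ⊗ M -> H^⊗2 ⊗_H N in curried form. Linearity over k is the case where
   f and g are scalars, see pseudo_scalel and pseudo_scaler. *)
Definition H2linear (L M N : lmodType H) (op : L -> M -> H2ten N) : Prop :=
  [/\ forall y, {morph op^~ y : x x' / x + x'},
      forall x, {morph op x : y y' / y + y'}
    & forall f g x y, op (f *: x) (g *: y) = (f ⊗ g : H2) *: op x y].

Lemma pseudo_scalel (L M N : lmodType H) (op : L -> M -> H2ten N) : H2linear op ->
  forall (c : k) x y, op (c%:A *: x) y = (c%:A : H2) *: op x y.
Proof.
by case=> _ _ h c x y; rewrite -[y in LHS]scale1r h ktensZl -ktens1.
Qed.

Lemma pseudo_scaler (L M N : lmodType H) (op : L -> M -> H2ten N) : H2linear op ->
  forall (c : k) x y, op x (c%:A *: y) = (c%:A : H2) *: op x y.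
Proof.
by case=> _ _ h c x y; rewrite -[x in LHS]scale1r h ktensZr -ktens1.
Qed.

(* The map H^⊗2 ⊗_H N -> H^⊗3 ⊗_H N induced by psi. *)
Definition H23 (N : lmodType H) (psi : H2 -> H3) : H2ten N -> H3ten N :=
  hlift (fun G n => htens comult3 (psi G) n).

(* The composites u * y and x * v for u in H^⊗2 ⊗_H L and v in H^⊗2 ⊗_H M, defined
   by their values on u = F ⊗_H x and v = F ⊗_H y. They are well defined, i.e.
   additive with these values, when op is H2linear (complDl, compl_tens, comprDr,
   compr_tens). *)
Definition compl (L M N : lmodType H) (op : L -> M -> H2ten N)
    (u : H2ten L) (y : M) : H3ten N :=
  hlift (fun F x => H23 (fun G => (F ⊗ 1 : H3) * comult_id G) (op x y)) u.

Definition compr (L M N : lmodType H) (op : L -> M -> H2ten N)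
    (x : L) (v : H2ten M) : H3ten N :=
  hlift (fun F y => H23 (fun G => kassoc (1 ⊗ F) * id_comult G) (op x y)) v.

Lemma comult_idM : {morph comult_id : F G / F * G}.
Proof. exact: rmorphM. Qed.
Lemma comult_idD : {morph comult_id : F G / F + G}.
Proof. exact: raddfD. Qed.
Lemma id_comultM : {morph id_comult : F G / F * G}.
Proof. by move=> F G; rewrite /id_comult /= !rmorphM. Qed.
Lemma id_comultD : {morph id_comult : F G / F + G}.
Proof. by move=> F G; rewrite /id_comult /= !raddfD. Qed.
Lemma comult3E h : comult3 h = id_comult (comult2 h).
Proof. exact: comultA. Qed.

Definition H23_compat (psi : H2 -> H3) :=
  {morph psi : F G / F + G} /\
  forall F h, psi (F * comult2 h) = psi F * comult3 h.

Lemma H23_bal (N : lmodType H) psi : H23_compat psi ->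
  balanced (hract comult2) (fun G (n : N) => htens comult3 (psi G) n).
Proof.
case=> psiD psiM; split=> [n G G'|G n n'|G h n] /=.
- by rewrite psiD htensDl.
- by rewrite htensDr.
- by rewrite /hract psiM htens_bal.
Qed.

Lemma compat_l (F : H2) : H23_compat (fun G => (F ⊗ 1 : H3) * comult_id G).
Proof.
by split=> [G G'|G h]; rewrite ?comult_idD ?mulrDr // comult_idM mulrA.
Qed.

Lemma compat_r (F : H2) : H23_compat (fun G => kassoc (1 ⊗ F) * id_comult G).
Proof.
by split=> [G G'|G h]; rewrite ?id_comultD ?mulrDr // id_comultM mulrA comult3E.
Qed.

Section Comp.
Context (L M N : lmodType H) (op : L -> M -> H2ten N) (op_lin : H2linear op).

Lemma H23_tens psi G (n : N) : H23_compat psi ->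
  H23 psi (htens comult2 G n) = htens comult3 (psi G) n.
Proof. by move=> h; exact: tliftE (H23_bal N h) _ _. Qed.

Lemma H23D psi : H23_compat psi -> {morph @H23 N psi : u v / u + v}.
Proof. by move=> h; exact: tliftD (H23_bal N h). Qed.

Lemma H23_shift psi psi' (X : H2) (u : H2ten N) :
  H23_compat psi -> H23_compat psi' -> (forall G, psi (X * G) = psi' G) ->
  H23 psi (X *: u) = H23 psi' u.
Proof.
move=> c c' e; move: u; apply: htens_eq => [u v|u v|G n] /=.
- by rewrite scalerDr H23D.
- exact: H23D.
- by rewrite scale_htens !H23_tens // e.
Qed.

Lemma H23_split psi psi' (u : H2ten N) :
  H23_compat psi -> H23_compat psi' ->
  H23 (fun G => psi G + psi' G) u = H23 psi u + H23 psi' u.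
Proof.
move=> c c'; have cc : H23_compat (fun G => psi G + psi' G).
  case: c c' => [D M'] [D' M'']; split=> [F G|F h]; first by rewrite D D' addrACA.
  by rewrite M' M'' mulrDl.
move: u; apply: htens_eq => [u v|u v|G n] /=.
- exact: H23D.
- by rewrite !H23D // addrACA.
- by rewrite !H23_tens // htensDl.
Qed.

Lemma compl_bal y : balanced (hract comult2)
  (fun F x => H23 (fun G => (F ⊗ 1 : H3) * comult_id G) (op x y)).
Proof.
case: (op_lin) => Dl _ eq2; split=> [x F F'|F x x'|F h x] /=.
- rewrite -H23_split; [|exact: compat_l..].
  by congr (H23 _ _); apply: funext => G; rewrite ktensDl mulrDl.
- by rewrite Dl H23D //; exact: compat_l.
- rewrite -[y in RHS]scale1r eq2; symmetry.
  apply: H23_shift; [exact: compat_l..|] => G.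
  rewrite comult_idM mulrA; congr (_ * _).
  by rewrite /comult_id kmapE ktensM mulr1.
Qed.

Lemma compl_tens F x y : compl op (htens comult2 F x) y =
  H23 (fun G => (F ⊗ 1 : H3) * comult_id G) (op x y).
Proof. exact: tliftE (compl_bal y) _ _. Qed.

Lemma complDl y : {morph compl op ^~ y : u v / u + v}.
Proof. exact: tliftD (compl_bal y). Qed.

Lemma compr_bal x : balanced (hract comult2)
  (fun F y => H23 (fun G => kassoc (1 ⊗ F) * id_comult G) (op x y)).
Proof.
case: (op_lin) => _ Dr eq2; split=> [y F F'|F y y'|F h y] /=.
- rewrite -H23_split; [|exact: compat_r..].
  by congr (H23 _ _); apply: funext => G; rewrite ktensDr raddfD mulrDl.
- by rewrite Dr H23D //; exact: compat_r.
- rewrite -[x in RHS]scale1r eq2; symmetry.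
  apply: H23_shift; [exact: compat_r..|] => G.
  rewrite id_comultM mulrA; congr (_ * _).
  by rewrite /id_comult /= kmapE -rmorphM ktensM mulr1.
Qed.

Lemma compr_tens x F y : compr op x (htens comult2 F y) =
  H23 (fun G => kassoc (1 ⊗ F) * id_comult G) (op x y).
Proof. exact: tliftE (compr_bal x) _ _. Qed.

Lemma comprDr x : {morph compr op x : u v / u + v}.
Proof. exact: tliftD (compr_bal x). Qed.
End Comp.

Record is_dendriform_family (Omega : semigroupType) (D : lmodType H)
    (prec succ : Omega -> D -> D -> H2ten D) : Prop := {
  prec_H2linear : forall a, H2linear (prec a);
  succ_H2linear : forall a, H2linear (succ a);
  prec_prec : forall x y z a b,
    compl (prec b) (prec a x y) z =
    compr (prec (a * b)%g) x (prec b y z + succ a y z);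
  succ_prec : forall x y z a b,
    compl (prec b) (succ a x y) z = compr (succ a) x (prec b y z);
  succ_succ : forall x y z a b,
    compl (succ (a * b)%g) (prec b x y + succ a x y) z =
    compr (succ a) x (succ b y z)
}.

Record is_Omega_associative (Omega : semigroupType) (A : lmodType H)
    (op : Omega -> Omega -> A -> A -> H2ten A) : Prop := {
  op_H2linear : forall a b, H2linear (op a b);
  op_assoc : forall x y z a b c,
    compl (op (a * b)%g c) (op a b x y) z =
    compr (op a (b * c)%g) x (op b c y z)
}.
End Pseudo.

(* Main.v *)
Require Import Defs.
From mathcomp Require Import all_boot all_algebra.
Import GRing.Theory.
Local Open Scope ring_scope.

(** Both composites are additive in the operation ([compl_opD], [compr_opD]) and, for an [H2linear]
    operation, in the composite argument. Expanding the two sides of associativity, each becomes the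
    sum of the two sides of the three dendriform axioms, taken at suitable indices. *)

Lemma H2linearD (k : fieldType) (H : hopfAlgType k) (L M N : lmodType H)
    (op op' : L -> M -> H2ten N) :
  H2linear op -> H2linear op' -> H2linear (fun x y => op x y + op' x y).
Proof.
move=> [Dl Dr S] [Dl' Dr' S']; split=> [y x x'|x y y'|f g x y] /=.
- by rewrite Dl Dl' addrACA.
- by rewrite Dr Dr' addrACA.
- by rewrite S S' scalerDr.
Qed.

(** Both sides are sums over the same representative [repr u], so they agree term by term by
    additivity of [H23]. *)
Lemma compl_opD (k : fieldType) (H : hopfAlgType k) (L M N : lmodType H)
    (op op' : L -> M -> H2ten N) (u : H2ten L) (y : M) :
  compl (fun x y => op x y + op' x y) u y = compl op u y + compl op' u y.
Proof.
rewrite /compl /hlift /tlift -big_split /=; apply: eq_bigr => p _.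
by rewrite H23D //; exact: compat_l.
Qed.

Lemma compr_opD (k : fieldType) (H : hopfAlgType k) (L M N : lmodType H)
    (op op' : L -> M -> H2ten N) (x : L) (v : H2ten M) :
  compr (fun x y => op x y + op' x y) x v = compr op x v + compr op' x v.
Proof.
rewrite /compr /hlift /tlift -big_split /=; apply: eq_bigr => p _.
by rewrite H23D //; exact: compat_r.
Qed.

Theorem corollary3p13 (k : closedFieldType) (k_pchar0 : [pchar k] =i pred0)
  (H : cocomHopfAlgType k) (Omega : semigroupType) (D : lmodType H)
  (prec succ : Omega -> D -> D -> H2ten D) :
  is_dendriform_family prec succ ->
  is_Omega_associative (fun (a b : Omega) (x y : D) => succ a x y + prec b x y).
Proof.
case=> precL succL pp sp ss; split=> [a b|x y z a b c]; first exact: H2linearD.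
rewrite compl_opD compr_opD [X in compl (succ _) X]addrC ss.
(* The left factor of [prec c] splits into a [succ a] part, handled by [sp], and a [prec b] part,
   which [pp] at indices [b], [c] turns into the [prec (b * c)] term. *)
rewrite (complDl (precL c)) sp pp (comprDr (succL a)) addrA.
by rewrite [X in compr (prec _) x X]addrC.
Qed.
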